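(* The one-dimensional star discrepancy constant $c^{\ast}$ satisfies $$c^{\ast}\geq 0.065664679.$$
   Context: For a sequence $\omega=(x_1,x_2,\ldots)$ in $[0,1)$ and $N\ge 1$, the star discrepancy of the first $N$ elements of $\omega$ is $$D^{\ast}_N(\omega)=\sup_{x\in[0,1]}\left|\frac{\mathcal{A}_N(x)}{N}-x\right|,\qquad \mathcal{A}_N(x):=\#\{1\leq n\leq N : x_n<x\}.$$ The one-dimensional star discrepancy constant $c^{\ast}$ is the supremum of all $c>0$ such that for every sequence $\omega$ in $[0,1)$ the inequality $D^{\ast}_N(\omega)>c\,\frac{\log N}{N}$ holds for infinitely many $N$. Equivalently, $$c^{\ast}=\inf_{\omega}\limsup_{N\to\infty}\frac{N D^{\ast}_N(\omega)}{\log N},$$ where the infimum is over all sequences $\omega$ in $[0,1)$. Here $\log$ is the natural logarithm. *)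

(* Defs.v *)
From HB Require Import structures.
From mathcomp Require Import all_boot all_order all_algebra.
From mathcomp Require Import all_classical all_reals all_analysis.

Set Implicit Arguments.
Unset Strict Implicit.
Unset Printing Implicit Defensive.
Import Order.TTheory GRing.Theory Num.Theory.
Local Open Scope classical_set_scope.
Local Open Scope ring_scope.

(* Sequences are indexed from 0: [w n] is the term x_(n+1), so that the first
   N terms are the [w n] with [n < N]. *)
Definition unit_sequence (R : realType) (w : nat -> R) : Prop :=
  forall n : nat, 0 <= w n < 1.

Definition count_below (R : realType) (w : nat -> R) (N : nat) (x : R) : nat :=
  #|[pred n : 'I_N | w n < x]|.

(* The set is nonempty and included in [0, 1], so the real-valued [sup] is its
   least upper bound. *)
Definition star_discrepancy (R : realType) (w : nat -> R) (N : nat) : R :=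
  sup [set `|(count_below w N x)%:R / N%:R - x| | x in `[0, 1]].

Definition discrepancy_lower_constant (R : realType) (c : R) : Prop :=
  forall w : nat -> R, unit_sequence w ->
    infinite_set [set N : nat | (0 < N)%N /\
      star_discrepancy w N > c * (ln N%:R / N%:R)].

(* The supremum is taken in the extended reals: the real-valued [sup] would be
   0 by default on an unbounded or empty set. *)
Definition star_discrepancy_constant (R : realType) : \bar R :=
  ereal_sup [set c%:E | c in [set c : R | 0 < c /\
    discrepancy_lower_constant c]].

(* Main.v *)
Require Import Defs.
From HB Require Import structures.
From mathcomp Require Import all_boot all_order all_algebra.
From mathcomp Require Import all_classical all_reals all_analysis.
From mathcomp Require Import ring lra zify.
Import Order.TTheory GRing.Theory Num.Theory.
Local Open Scope classical_set_scope.
Local Open Scope ring_scope.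

(** Write [Delta_n(x) = #{j < n : w_j < x} - n x].  If [N D*_N <= c ln N] for all
large [N], then on a block [I] of consecutive indices up to [N] the spread
[max_I Delta - min_I Delta] is at most [2 c ln N] at every [x].  The proof
bounds the spread from below on average over [x].

Cut a block of length [4 L] into a first quarter [I'], a middle half and a last
quarter [I''], and let [f = max_I'' Delta - max_I' Delta].  Since
[max (a, b) = (a + b + |a - b|) / 2], the spread of the whole block is at least
the mean of the spreads of [I'] and [I''], plus half of [|f|], plus half of the
same quantity for the minima ([spread_split]).  Hence a bound [K] for the
average of [|f|] over [x] gives a spread of at least [t K] on blocks of length
[4 ^ t] ([spread_average]), and [c >= K / (2 ln 4)] follows.

The core is the bound on the average of [|f|] ([gap_average]).  Let [p] and [q]
be the indices in [I'] and [I''] where the maxima are reached.  As [x] grows,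
[f] decreases with slope [q - p], and
- a term [w_j] with [j] in the middle half makes [f] jump by exactly [1] and
  keeps [p] and [q];
- a term with [j] in [I'] or [I''] makes [f] jump up by some amount;
- between two terms, [p] and [q] can only decrease, because [Delta_n] has slope
  [- n].
So the slope [q - p] lies between [2 L] and [4 L], but it cannot be adjusted
freely: [p] grows, and [q] grows, only at the [2 L] terms of [I'] and [I''].  A
configuration with small average of [|f|] would need a small slope while [|f| < K]
and a large one while [|f| > K].

This is quantified by a potential [V (f, r, s)], with [r = 1 - p / L] and
[s = q / L - 3] in [[0, 1]].  Along the motion it increases by at most
the integral of [4 L (|f| - K)]; it drops by at least [2 K^2] at each of the
[2 L] terms of the middle half, and rises by at most [2 K^2] at each of the [2 L]
others.  At [x = 0] and [x = 1] all the [Delta_n] vanish, and the value at the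
end is not smaller than at the start, so the integral is nonnegative.  Such a
potential exists as soon as [K + 2 K^2 <= 1/4], that is up to
[K = (sqrt 3 - 1) / 4 = 0.18301...].  The value [K = 73 / 400] gives
[K / (4 ln 2) > 0.0658].

Integrals are avoided by averaging over the midpoints of the cells
[[i / G, (i + 1) / G[], where [G] is divisible by every positive integer up to
the length of the block, and every [w_j] is moved to the left end of its cell.
Two functions [Delta_n] and [Delta_m] can only cross at multiples of
[1 / (m - n)], hence never inside a cell, so that everything is affine there and
midpoint values are exact means. *)

(** * The potential *)

Definition odd_ext {R : realFieldType} (g : R -> R) (y : R) : R :=
  if 0 <= y then g y else - g (- y).

Lemma odd_ext_nneg (R : realFieldType) (g : R -> R) (y : R) :
  0 <= y -> odd_ext g y = g y.
Proof. by rewrite /odd_ext => ->. Qed.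

Lemma odd_ext_neg (R : realFieldType) (g : R -> R) (y : R) :
  y < 0 -> odd_ext g y = - g (- y).
Proof. by rewrite /odd_ext ltNge => /negbTE ->. Qed.

Lemma odd_ext_homo (R : realFieldType) (g : R -> R) :
  0 <= g 0 -> (forall t u, 0 <= t -> t <= u -> g t <= g u) ->
  {homo odd_ext g : x y / x <= y}.
Proof.
move=> g0 gm x y xy; rewrite /odd_ext.
case: (lerP 0 x) => x0; case: (lerP 0 y) => y0.
- exact: gm.
- lra.
- have := gm 0 (- x); have := gm 0 y; lra.
- by rewrite lerN2; apply: gm; lra.
Qed.

Definition excess_half {R : realFieldType} (K t : R) : R := t ^+ 2 / 2 - K * t.

(** The primitive of [|y| - K] that vanishes at [0]. *)
Definition excess {R : realFieldType} (K : R) := odd_ext (excess_half K).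

(** The part of the potential that exploits the variations of the slope.  On
[[0, K]] it is minus the primitive of [|y| - K]; beyond, it returns to [0] as
fast as [excess_correction2_homo] permits, so that it does not spoil the unit
jumps from about [-1/2] to about [1/2]. *)
Definition correction_half {R : realFieldType} (K t : R) : R :=
  if t <= K then K * t - t ^+ 2 / 2
  else Num.max 0 (K ^+ 2 / 2 - (t - K) ^+ 2 / 4).

Definition correction {R : realFieldType} (K : R) := odd_ext (correction_half K).

Lemma correction_half_bound (R : realFieldType) (K t : R) :
  0 <= K -> 0 <= t -> 0 <= correction_half K t <= K ^+ 2 / 2.
Proof.
move=> K0 t0; rewrite /correction_half; case: ifPn => [tK|]; first by nra.
rewrite -ltNge => tK; rewrite maxEle; case: ifPn; nra.
Qed.

Lemma correction_bound (R : realFieldType) (K y : R) :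
  0 <= K -> - (K ^+ 2 / 2) <= correction K y <= K ^+ 2 / 2.
Proof.
move=> K0; rewrite /correction /odd_ext; case: (lerP 0 y) => y0.
  have := correction_half_bound R K y K0 y0; lra.
have /(correction_half_bound R K _ K0) : 0 <= - y by lra.
lra.
Qed.

(** This and the next lemma say that the derivatives of [excess] and
[correction] satisfy [|y| - K + m * correction' >= 0] for [m = 1] and [m = 2],
hence for every [m] in [[1, 2]]; in [potential_flow], [m] is twice the slope
measured in units of [4 L]. *)
Lemma excess_correction_homo (R : realFieldType) (K : R) : 0 <= K ->
  {homo (fun y => excess K y + correction K y) : x y / x <= y}.
Proof.
move=> K0 x y xy.
have E z : excess K z + correction K z
    = odd_ext (fun t => excess_half K t + correction_half K t) z.
  by rewrite /excess /correction /odd_ext; case: ifP => _ //; ring.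
rewrite !E; apply: odd_ext_homo xy; first by rewrite /excess_half /correction_half K0; lra.
move=> t u t0 tu; rewrite /excess_half /correction_half.
case: (lerP t K) => tK; case: (lerP u K) => uK; rewrite ?maxEle;
  repeat case: ifPn; rewrite -?ltNge => *; nra.
Qed.

Lemma excess_correction2_homo (R : realFieldType) (K : R) : 0 <= K ->
  {homo (fun y => excess K y + 2 * correction K y) : x y / x <= y}.
Proof.
move=> K0 x y xy.
have E z : excess K z + 2 * correction K z
    = odd_ext (fun t => excess_half K t + 2 * correction_half K t) z.
  by rewrite /excess /correction /odd_ext; case: ifP => _ //; ring.
rewrite !E; apply: odd_ext_homo xy; first by rewrite /excess_half /correction_half K0; lra.
move=> t u t0 tu; rewrite /excess_half /correction_half.
case: (lerP t K) => tK; case: (lerP u K) => uK; rewrite ?maxEle;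
  repeat case: ifPn; rewrite -?ltNge => *; nra.
Qed.

(** With [y = -1/2 + e] the increment of [excess] is [1/4 - K + e^2] as long as
[|e| <= 1/2]: this is where the condition on [K] comes from. *)
Lemma excess_unit (R : realFieldType) (K y : R) :
  0 <= K -> K + 2 * K ^+ 2 <= 1 / 4 ->
  2 * K ^+ 2 + (y + 1/2)^+2 <= excess K (y + 1) - excess K y
  \/ 3 * K ^+ 2 <= excess K (y + 1) - excess K y.
Proof.
move=> K0 K1; rewrite /excess /odd_ext /excess_half.
case: (lerP 0 y) => y0; case: (lerP 0 (y + 1)) => y1; [right|right|left|right]; nra.
Qed.

(** Only jumps from [-1/2 + e] with [|e| < K] need an argument, the others being
covered by the bound on [correction].  There both ends of the jump lie outside
[[-K, K]] since [K <= 1/5]. *)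
Lemma excess_correction_unit (R : realFieldType) (K y : R) :
  0 <= K -> K + 2 * K ^+ 2 <= 1 / 4 ->
  2 * K ^+ 2 <= excess K (y + 1) - excess K y
               - (correction K (y + 1) - correction K y).
Proof.
move=> K0 K1.
have := correction_bound R K y K0; have := correction_bound R K (y + 1) K0.
case: (excess_unit R K y K0 K1) => [c|]; last by lra.
case: (lerP (K ^+ 2) ((y + 1/2)^+2)) => [|e]; first by lra.
move=> _ _.
have K4 : K <= 1/5 by nra.
have y1 : - K < y + 1/2 by nra.
have y2 : y + 1/2 < K by nra.
have neg : y < 0 by lra.
have nneg : 0 <= y + 1 by lra.
rewrite /correction /excess !(odd_ext_neg _ _ _ neg) !(odd_ext_nneg _ _ _ nneg).
have [f1 f2] : (y + 1 <= K = false) * (- y <= K = false) by split; apply: lt_geF; lra.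
rewrite /excess_half /correction_half f1 f2.
(* With [d = 1/2 - K], the condition on [K] reads [3 K^2 <= d^2]. *)
have h : 3 * K ^+ 2 <= (1/2 - K) ^+ 2 by lra.
have h1 := sqr_ge0 ((y + 1/2) + (1/2 - K) / 5).
have h2 := sqr_ge0 ((y + 1/2) - (1/2 - K) / 5).
have h3 := sqr_ge0 (1/2 - K).
have h4 := sqr_ge0 (y + 1/2).
rewrite !maxEle; case: ifPn => _; case: ifPn => _; lra.
Qed.

(** [r] and [s] measure how far the two maximizing indices are from their
positions of least slope: [f] decreases at the rate [4 L (1/2 + (r + s) / 4)].
At the greatest rate, [r = s = 1], only [- excess] is left.  The last term, of
the size of the bound on [correction], makes the potential monotone in [r] and
in [s], as [potential_switch] requires. *)
Definition potential {R : realFieldType} (K y r s : R) : R :=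
  - excess K y + (1 - (r + s) / 2) * correction K y + (s - r) * (K ^+ 2 / 4).

(** [excess] can only decrease where [correction] increases as much, and the
latter has range of length [K^2]. *)
Lemma excess_drop (R : realFieldType) (K x y : R) :
  0 <= K -> x <= y -> excess K x - excess K y <= K ^+ 2.
Proof.
move=> K0 xy.
have := excess_correction_homo R K K0 x y xy.
have := correction_bound R K x K0; have := correction_bound R K y K0; lra.
Qed.

(** The bounds on the drop of [excess] and on [correction] cover every change of [r] and
[s], so the maximizing indices may move in any way. *)
Lemma potential_jump (R : realFieldType) (K x y r s r' s' : R) :
  0 <= K -> x <= y -> 0 <= r <= 1 -> 0 <= s <= 1 -> 0 <= r' <= 1 ->
  0 <= s' <= 1 -> potential K y r' s' - potential K x r s <= 2 * K ^+ 2.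
Proof.
move=> K0 xy r01 s01 r01' s01'; rewrite /potential.
have d := excess_drop R K x y K0 xy.
have /andP[cx1 cx2] := correction_bound R K x K0.
have /andP[cy1 cy2] := correction_bound R K y K0.
have p1 : (1 - (r' + s') / 2) * correction K y <= (1 - (r' + s') / 2) * (K ^+ 2 / 2).
  by apply: ler_wpM2l => //; lra.
have p2 : (1 - (r + s) / 2) * (- correction K x) <= (1 - (r + s) / 2) * (K ^+ 2 / 2).
  by apply: ler_wpM2l; lra.
have k2 := sqr_ge0 K.
have p3 : 0 <= (r' + s) * K ^+ 2 by apply: mulr_ge0 => //; lra.
lra.
Qed.

Lemma potential_unit (R : realFieldType) (K y r s : R) :
  0 <= K -> K + 2 * K ^+ 2 <= 1 / 4 -> 0 <= r <= 1 -> 0 <= s <= 1 ->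
  potential K (y + 1) r s - potential K y r s <= - (2 * K ^+ 2).
Proof.
move=> K0 K1 r01 s01; rewrite /potential.
have d0 : 2 * K ^+ 2 <= excess K (y + 1) - excess K y.
  by case: (excess_unit R K y K0 K1); have := sqr_ge0 (y + 1 / 2); have := sqr_ge0 K; lra.
have d1 := excess_correction_unit R K y K0 K1.
set a := excess K _ in d0 d1 *; set b := excess K _ in d0 d1 *.
set c := correction K _ in d1 *; set d := correction K _ in d1 *.
set w := (1 - (r + s) / 2).
have w01 : 0 <= w <= 1 by rewrite /w; lra.
have := @ler_wpM2l R w _ _ _ d1; have := @ler_wpM2l R (1 - w) _ _ _ d0; lra.
Qed.

(** Between two terms of the sequence the maximizing indices can only decrease,
that is, [r] grows and [s] decreases, which costs nothing. *)
Lemma potential_switch (R : realFieldType) (K y r s r' s' : R) :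
  0 <= K -> r <= r' -> s' <= s ->
  potential K y r' s' <= potential K y r s.
Proof.
move=> K0 rr ss; rewrite /potential.
have /andP[c1 c2] := correction_bound R K y K0.
have := @ler_wpM2l R (r' - r) _ _ _ c1; have := @ler_wpM2l R (s - s') _ _ _ c2; lra.
Qed.

(** With slope [m / 2] (in units of [4 L]), the difference of the two sides is
[(2 - m) / 2] times the increment of [excess + m * correction], which is a
convex combination of those of [excess + correction] and
[excess + 2 * correction]. *)
Lemma potential_flow (R : realFieldType) (K x y r s : R) :
  0 <= K -> 0 <= r <= 1 -> 0 <= s <= 1 -> x <= y ->
  (1 / 2 + (r + s) / 4) * (potential K x r s - potential K y r s)
    <= excess K y - excess K x.
Proof.
move=> K0 r01 s01 xy; rewrite /potential.
have h1 := excess_correction_homo R K K0 x y xy.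
have /= h2 := excess_correction2_homo R K K0 x y xy.
set w := (r + s) / 2.
have w01 : 0 <= w <= 1 by rewrite /w; lra.
have -> : 1 / 2 + (r + s) / 4 = (1 + w) / 2 by rewrite /w; lra.
have e1 : 0 <= (1 - w) * ((1 - w) * ((excess K y + correction K y)
    - (excess K x + correction K x))).
  by apply: mulr_ge0; [lra|apply: mulr_ge0; lra].
have e2 : 0 <= (1 - w) * (w * ((excess K y + 2 * correction K y)
    - (excess K x + 2 * correction K x))).
  by apply: mulr_ge0; [lra|apply: mulr_ge0; lra].
lra.
Qed.

Lemma excess_segment (R : realFieldType) (K x y : R) :
  (0 <= x <= y) || (x <= y <= 0) ->
  excess K y - excess K x = (y - x) * (`|(x + y) / 2| - K).
Proof.
have P z : 0 <= z -> excess K z = z ^+ 2 / 2 - K * z.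
  by move=> z0; rewrite /excess odd_ext_nneg.
have N z : z <= 0 -> excess K z = - (z ^+ 2 / 2) - K * z.
  rewrite le_eqVlt => /orP[/eqP->|z0]; first by rewrite P //; lra.
  by rewrite /excess odd_ext_neg // /excess_half; ring.
case/orP => /andP[h1 h2].
  by rewrite !P ?ger0_norm; [field|lra|lra|lra].
by rewrite !N ?ler0_norm; [field|lra|lra|lra].
Qed.

(** * Maxima over blocks of indices *)

Definition argmax_on {R : realFieldType} (E : nat -> R) (a L p : nat) : Prop :=
  (a <= p <= a + L)%N /\ forall k, (a <= k <= a + L)%N -> E k <= E p.

Definition block_max {R : realFieldType} (E : nat -> R) (a L : nat) : R :=
  E (a + [arg max_(k > (ord0 : 'I_L.+1)) E (a + k)%N]%O)%N.

Lemma block_max_argmax (R : realFieldType) (E : nat -> R) (a L : nat) :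
  exists2 p, argmax_on E a L p & block_max E a L = E p.
Proof.
rewrite /block_max; case: arg_maxP => // k _ kmax.
exists (a + k)%N => //; split; first by have := ltn_ord k; lia.
move=> n an; have nL : (n - a < L.+1)%N by lia.
have := kmax (Ordinal nL) isT; rewrite /=.
by have -> : (a + (n - a) = n)%N by lia.
Qed.

Lemma block_maxE (R : realFieldType) (E : nat -> R) (a L p : nat) :
  argmax_on E a L p -> block_max E a L = E p.
Proof.
move=> [pin pmax]; have [q [qin qmax] ->] := block_max_argmax R E a L.
by apply/eqP; rewrite eq_le pmax // qmax.
Qed.

Lemma argmax_on_least (R : realFieldType) (E : nat -> R) (a L : nat) :
  exists p, argmax_on E a L p /\ forall k, (a <= k < p)%N -> E k < E p.
Proof.
have [p0 [pin pmax] _] := block_max_argmax R E a L.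
have ex : exists n, (a <= n <= a + L)%N && (E n == E p0) by exists p0; rewrite pin /=.
case: (ex_minnP ex) => p /andP[pin' /eqP pE] pleast.
exists p; split; first by split=> // k /pmax; rewrite pE.
move=> k kp; rewrite pE lt_neqAle pmax ?andbT; last by lia.
by apply/negP => kE; have := pleast k; rewrite kE andbT; lia.
Qed.

(** The values that the potential takes at the profile [E] for the possible
choices of the maximizing indices; ties make several values possible. *)
Definition attained {R : realFieldType} (K : R) (L : nat) (E : nat -> R) (v : R)
    : Prop :=
  exists p q, [/\ argmax_on E 0 L p, argmax_on E (3 * L) L q
    & v = potential K (E q - E p) (1 - p%:R / L%:R) (q%:R / L%:R - 3)].

Lemma left_offset (R : realFieldType) (E : nat -> R) (L p : nat) : (0 < L)%N ->
  argmax_on E 0 L p -> 0 <= (1 - p%:R / L%:R : R) <= 1.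
Proof.
move=> L0 [pin _]; have L0' : 0 < L%:R :> R by rewrite ltr0n.
have h : 0 <= (p%:R / L%:R : R) <= 1.
  by rewrite divr_ge0 ?ler0n //= ler_pdivrMr // mul1r ler_nat; lia.
lra.
Qed.

Lemma right_offset (R : realFieldType) (E : nat -> R) (L q : nat) : (0 < L)%N ->
  argmax_on E (3 * L) L q -> 0 <= (q%:R / L%:R - 3 : R) <= 1.
Proof.
move=> L0 [qin _]; have L0' : 0 < L%:R :> R by rewrite ltr0n.
have h : 3 <= (q%:R / L%:R : R) <= 4.
  by rewrite ler_pdivlMr // ler_pdivrMr // -!natrM !ler_nat; lia.
lra.
Qed.

Lemma attained_ext (R : realFieldType) (K : R) (L : nat) (E E' : nat -> R) (v : R) :
  (forall n, (n <= 4 * L)%N -> E n = E' n) ->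
  attained K L E v -> attained K L E' v.
Proof.
move=> EE [p [q [[pin pmax] [qin qmax] ->]]]; exists p, q; split.
- by split=> // k kin; rewrite -!EE; [exact: pmax|lia|lia].
- by split=> // k kin; rewrite -!EE; [exact: qmax|lia|lia].
- by rewrite !EE //; lia.
Qed.

(** * Evolution of the potential *)

(** The bound on the growth of the potential when the term of index [j] is
passed. *)
Definition point_cost {R : realFieldType} (K : R) (L j : nat) : R :=
  if (L <= j < 3 * L)%N then - (2 * K ^+ 2) else 2 * K ^+ 2.

(** A term in the middle half shifts all of the last quarter and nothing of the
first one, so [f] gains exactly [1] and the maximizers stay.  Any other term
shifts the last quarter entirely or not the first one at all, so [f] does not
decrease, and [potential_jump] handles whatever new maximizers appear. *)
Lemma attained_point (R : realFieldType) (K : R) (L j : nat) (E : nat -> R) (v : R) :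
  0 <= K -> K + 2 * K ^+ 2 <= 1 / 4 -> (0 < L)%N -> (j < 4 * L)%N ->
  attained K L E v ->
  exists2 v', attained K L (fun n => E n + (j < n)%:R) v'
    & v' <= v + point_cost K L j.
Proof.
move=> K0 K1 L0 jL [p [q [Ap Aq ->]]]; have [pin pmax] := Ap.
have [qin qmax] := Aq; rewrite /point_cost; case: ifP => [jmid|jend].
  have jp : (j < p)%N = false by lia.
  have jq : (j < q)%N = true by lia.
  eexists; first exists p, q; first split; [split=> // k kin|split=> // k kin|reflexivity|].
  - by have -> : (j < k)%N = false; [lia|rewrite jp !addr0 pmax].
  - by have -> : (j < k)%N = true; [lia|rewrite jq lerD2r qmax].
  - rewrite jp jq.
    have -> : E q + true%:R - (E p + false%:R) = E q - E p + 1 by rewrite /=; ring.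
    have := potential_unit R K (E q - E p) _ _ K0 K1
      (left_offset R E L p L0 Ap) (right_offset R E L q L0 Aq); lra.
pose E' n : R := E n + (j < n)%:R.
have [p' Ap' _] := block_max_argmax R E' 0 L.
have [q' Aq' _] := block_max_argmax R E' (3 * L) L.
have [pin' pmax'] := Ap'; have [qin' qmax'] := Aq'.
eexists; first by exists p', q'; split=> //.
have grow : E q - E p <= E' q' - E' p'.
  have hq := qmax' q qin; have hp := pmax p' pin'; move: hq; rewrite {1 4}/E'.
  have [jL1|jL1] := ltnP j L.
    rewrite (_ : (j < q)%N) /=; last lia.
    by case: (j < p')%N => /=; lra.
  have -> : (j < p')%N = false by lia.
  by case: (j < q)%N => /=; lra.
have := potential_jump R K _ _ _ _ _ _ K0 grow (left_offset R E L p L0 Ap)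
  (right_offset R E L q L0 Aq) (left_offset R E' L p' L0 Ap')
  (right_offset R E' L q' L0 Aq'); lra.
Qed.

Lemma attained_points (R : realFieldType) (K : R) (L k : nat) (P : pred nat)
    (E : nat -> R) (v : R) :
  0 <= K -> K + 2 * K ^+ 2 <= 1 / 4 -> (0 < L)%N -> (k <= 4 * L)%N ->
  attained K L E v ->
  exists2 v', attained K L (fun n => E n + (\sum_(j < k) (P j && (j < n)))%N%:R) v'
    & v' <= v + \sum_(j < k | P j) point_cost K L j.
Proof.
move=> K0 K1 L0 kL Ev; elim: k kL => [|k IH] kL.
  exists v; last by rewrite big_ord0; lra.
  by apply: attained_ext Ev => n _; rewrite big_ord0 addr0.
have [v' Ev' v'v] := IH (ltnW kL).
rewrite big_mkcond big_ord_recr /= -big_mkcond /=; case: ifP => Pk; last first.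
  exists v'; last by rewrite addr0.
  by apply: attained_ext Ev' => n _; rewrite big_ord_recr /= Pk addn0.
have [w Ew wv'] := attained_point R K L k _ _ K0 K1 L0 kL Ev'.
exists w; last by lra.
by apply: attained_ext Ew => n _; rewrite big_ord_recr /= Pk natrD addrA.
Qed.

(** No two of the functions [E n - n t] cross strictly between [t = 0] and
[t = tau]. *)
Definition uncrossed {R : realFieldType} (N : nat) (tau : R) (E : nat -> R) : Prop :=
  forall n m, (n < m <= N)%N -> E m <= E n \/ E n + (m - n)%:R * tau <= E m.

(** Among tied maximizers the least index wins at once, since its value
decreases most slowly; without crossings it stays a maximizer. *)
Lemma argmax_on_flow (R : realFieldType) (E : nat -> R) (a L p : nat) (tau t : R) :
  uncrossed (a + L) tau E -> 0 <= t <= tau -> argmax_on E a L p ->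
  (forall k, (a <= k < p)%N -> E k < E p) ->
  argmax_on (fun n => E n - n%:R * t) a L p.
Proof.
move=> unc tt [pin pmax] pleast; split=> // k kin; have /= := pmax k kin.
have [kp|kp] := ltnP k p; last first.
  have : p%:R * t <= k%:R * t by apply: ler_wpM2r; [lra|rewrite ler_nat].
  lra.
have : E k < E p by apply: pleast; lia.
have pk : (k < p <= a + L)%N by lia.
have := unc k p pk; rewrite natrB; last exact: ltnW.
have : (p%:R - k%:R) * t <= (p%:R - k%:R) * tau.
  by apply: ler_wpM2l; [rewrite subr_ge0 ler_nat ltnW|lra].
by move=> h1 [|]; lra.
Qed.

(** The change of the potential over a crossing-free motion of duration [tau] is
at most [4 L] times the integral of [|f| - K], which equals [tau] times its
value at [tau / 2] because [f] is affine of constant sign. *)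
Lemma attained_flow (R : realFieldType) (K : R) (L : nat) (E : nat -> R) (v tau : R) :
  0 <= K -> (0 < L)%N -> 0 <= tau -> uncrossed (4 * L) tau E ->
  attained K L E v ->
  exists2 v', attained K L (fun n => E n - n%:R * tau) v'
    & v' <= v + (4 * L)%:R * tau *
        (`|block_max (fun n => E n - n%:R * (tau / 2)) (3 * L) L
           - block_max (fun n => E n - n%:R * (tau / 2)) 0 L| - K).
Proof.
move=> K0 L0 tau0 unc [p0 [q0 [[p0in p0max] [q0in q0max] ->]]].
have L0' : 0 < L%:R :> R by rewrite ltr0n.
have [p [Ap pleast]] := argmax_on_least R E 0 L.
have [q [Aq qleast]] := argmax_on_least R E (3 * L) L.
have [pin pmax] := Ap; have [qin qmax] := Aq.
have uncL : uncrossed (0 + L) tau E by move=> n m nm; apply: unc; lia.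
have uncR : uncrossed (3 * L + L) tau E by move=> n m nm; apply: unc; lia.
have Epq : E q0 - E p0 = E q - E p.
  have : E q0 = E q by apply/eqP; rewrite eq_le qmax // q0max.
  have : E p0 = E p by apply/eqP; rewrite eq_le pmax // p0max.
  by move=> -> ->.
have pp0 : (p <= p0)%N.
  by rewrite leqNgt; apply/negP => pp; have := pleast p0 pp; have := p0max p pin; lra.
have qq0 : (q <= q0)%N.
  rewrite leqNgt; apply/negP => qq; have : (3 * L <= q0 < q)%N by lia.
  by move=> /qleast; have := q0max q qin; lra.
have half : 0 <= tau / 2 <= tau by lra.
have full : 0 <= tau <= tau by lra.
eexists.
  exists p, q; split; last reflexivity.
  - exact: argmax_on_flow uncL full Ap pleast.
  - exact: argmax_on_flow uncR full Aq qleast.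
rewrite (block_maxE _ _ 0 L p); last exact: argmax_on_flow uncL half Ap pleast.
rewrite (block_maxE _ _ (3 * L) L q); last exact: argmax_on_flow uncR half Aq qleast.
have sw : potential K (E q - E p) (1 - p%:R / L%:R) (q%:R / L%:R - 3)
       <= potential K (E q0 - E p0) (1 - p0%:R / L%:R) (q0%:R / L%:R - 3).
  rewrite Epq; apply: potential_switch => //.
    by rewrite lerD2l lerN2 ler_pM2r ?invr_gt0 // ler_nat.
  by rewrite lerD2r ler_pM2r ?invr_gt0 // ler_nat.
apply: le_trans (lerD sw (lexx _)) => {sw}.
have pq : (p < q <= 4 * L)%N by lia.
have slope0 : 0 < (q%:R - p%:R : R) by rewrite subr_gt0 ltr_nat; lia.
have sl : 0 <= (q%:R - p%:R) * tau by apply: mulr_ge0 => //; lra.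
set y := E q - E p; set y' := E q - q%:R * tau - (E p - p%:R * tau).
have yy' : y' = y - (q%:R - p%:R) * tau by rewrite /y /y'; ring.
have y'y : y' <= y by lra.
(* No crossing means that [f] keeps its sign, as [p < q]. *)
have sgn : (0 <= y' <= y) || (y' <= y <= 0).
  have := unc p q pq; rewrite natrB; last by lia.
  move=> [h|h]; apply/orP; [right|left]; apply/andP; split=> //; rewrite ?yy' /y; lra.
have mid : E q - q%:R * (tau / 2) - (E p - p%:R * (tau / 2)) = (y' + y) / 2.
  by rewrite /y /y'; field.
rewrite mid.
have := potential_flow R K y' y _ _ K0 (left_offset R E L p L0 Ap)
  (right_offset R E L q L0 Aq) y'y.
rewrite excess_segment //.
have -> : 1 / 2 + (1 - p%:R / L%:R + (q%:R / L%:R - 3)) / 4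
    = (q%:R - p%:R) / (4 * L)%:R :> R.
  by rewrite natrM; field; rewrite gt_eqF.
have -> : y - y' = (q%:R - p%:R) * tau by rewrite yy'; ring.
set X := `|_| - K; set W := potential K y' _ _ - _; set a := q%:R - p%:R.
have N0 : 0 < (4 * L)%:R :> R by rewrite ltr0n muln_gt0 L0.
move=> bound; suff : W <= (4 * L)%:R * tau * X by rewrite /W; lra.
rewrite -(ler_pM2l slope0) -/a.
have -> : a * W = (4 * L)%:R * (a / (4 * L)%:R * W) by field; rewrite gt_eqF.
have -> : a * ((4 * L)%:R * tau * X) = (4 * L)%:R * (a * tau * X) by ring.
by rewrite ler_pM2l.
Qed.

(** * The average gap between the first and the last quarter *)

Definition hits (z : nat -> nat) (i n : nat) : nat := (\sum_(j < n) (z j < i))%N.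

(** The function [Delta_n] at the middle of the cell of index [i], for terms
[z j] rounded to cells. *)
Definition profile (R : realFieldType) (z : nat -> nat) (G i n : nat) : R :=
  (hits z i.+1 n)%:R - n%:R * ((i%:R + 1 / 2) / G%:R).

Lemma hits_le (z : nat -> nat) (i n m : nat) : (n <= m)%N -> (hits z i n <= hits z i m)%N.
Proof.
rewrite /hits => nm.
rewrite -!(big_mkord xpredT (fun j => nat_of_bool (z j < i)%N)).
by rewrite [leqRHS](big_cat_nat _ nm) //= leq_addr.
Qed.

(** [hits m - hits n - (m - n) x] with [m - n] dividing [G] can only vanish at
multiples of [1 / G]. *)
Lemma uncrossed_hits (R : realFieldType) (z : nat -> nat) (N G i : nat) :
  (0 < G)%N -> (forall d, (0 < d <= N)%N -> (d %| G)%N) ->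
  uncrossed N (G%:R^-1 : R) (fun n => (hits z i.+1 n)%:R - n%:R * (i%:R / G%:R)).
Proof.
move=> G0 dG n m nm.
have G0' : 0 < G%:R :> R by rewrite ltr0n.
have /dvdnP [g Gg] : (m - n %| G)%N by apply: dG; lia.
set h := (hits z i.+1 m - hits z i.+1 n)%N.
have hE : (hits z i.+1 m)%:R = (hits z i.+1 n)%:R + h%:R :> R.
  by rewrite -natrD subnKC // hits_le //; lia.
have mE : m%:R = n%:R + (m - n)%:R :> R by rewrite -natrD subnKC //; lia.
have GR : G%:R = g%:R * (m - n)%:R :> R by rewrite Gg natrM.
have d0 : 0 < (m - n)%:R :> R by rewrite ltr0n; lia.
have g0 : 0 < g%:R :> R by rewrite ltr0n; case: (g) Gg G0 => //; lia.
rewrite hE mE.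
have invG : G%:R^-1 = g%:R^-1 / (m - n)%:R :> R by rewrite GR invfM.
have hi : (m - n)%:R * (i%:R / G%:R) = i%:R / g%:R :> R.
  by rewrite invG; field; rewrite !gt_eqF.
have hi1 : (m - n)%:R * G%:R^-1 = 1 / g%:R :> R.
  by rewrite invG; field; rewrite !gt_eqF.
rewrite [(n%:R + _) * _]mulrDl hi hi1.
have [hgi|hgi] := leqP (h * g) i; [left|right].
  have : h%:R <= i%:R / g%:R :> R by rewrite ler_pdivlMr // -natrM ler_nat.
  lra.
have : i%:R / g%:R + 1 / g%:R <= h%:R :> R.
  by rewrite -mulrDl ler_pdivrMr // -natrM natr1 ler_nat.
lra.
Qed.

(** The [2 L] terms of the middle half pay for the [2 L] others. *)
Lemma sum_point_cost (R : realFieldType) (K : R) (L : nat) :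
  \sum_(j < 4 * L) point_cost K L j = 0.
Proof.
have part a b c : (a <= b)%N -> (forall j, (a <= j < b)%N -> point_cost K L j = c) ->
    \sum_(a <= j < b) point_cost K L j = (b - a)%:R * c.
  move=> ab H; rewrite (eq_big_nat _ _ H) big_const_nat iter_addr addr0 mulr_natl.
  by [].
rewrite -(big_mkord xpredT) (big_cat_nat (n := L)) //=; last by lia.
rewrite (big_cat_nat (m := L) (n := 3 * L)) //=; [|lia|lia].
rewrite (part 0%N L (2 * K ^+ 2)); first last.
- by move=> j jj; rewrite /point_cost ifF //; lia.
- by [].
rewrite (part L (3 * L)%N (- (2 * K ^+ 2))); first last.
- by move=> j jj; rewrite /point_cost ifT.
- by lia.
rewrite (part (3 * L)%N (4 * L)%N (2 * K ^+ 2)); first last.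
- by move=> j jj; rewrite /point_cost ifF //; lia.
- by lia.
have -> : (3 * L - L = 2 * L)%N by lia.
by have -> : (4 * L - 3 * L = L)%N; [lia|rewrite subn0 natrM; ring].
Qed.

Definition gap {R : realFieldType} (E : nat -> R) (a L : nat) : R :=
  block_max E (a + 3 * L) L - block_max E a L.

(** Invariant at the left end of the cell of index [i], before its terms are
passed.  The initial value is the least possible one at [f = 0]: all the
[Delta_n] vanish, and the choice [p = 0], [q = 3 L] gives [r = 1], [s = 0]. *)
Lemma attained_line (R : realFieldType) (K : R) (z : nat -> nat) (L G i : nat) :
  0 <= K -> K + 2 * K ^+ 2 <= 1 / 4 -> (0 < L)%N -> (0 < G)%N ->
  (forall d, (0 < d <= 4 * L)%N -> (d %| G)%N) ->
  exists2 v, attained K L (fun n => (hits z i n)%:R - n%:R * (i%:R / G%:R)) v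
    & v <= - (K ^+ 2 / 4)
        + \sum_(i' < i) \sum_(j < 4 * L | z j == i') point_cost K L j
        + (4 * L)%:R / G%:R * \sum_(i' < i) (`|gap (profile R z G i') 0 L| - K).
Proof.
move=> K0 K1 L0 G0 dG; have G0' : 0 < G%:R :> R by rewrite ltr0n.
have L0' : 0 < L%:R :> R by rewrite ltr0n.
elim: i => [|i [v Ev vle]].
  have z0 n : (hits z 0 n)%:R - n%:R * (0%:R / G%:R) = 0 :> R.
    by rewrite /hits big1 // mul0r mulr0 subr0.
  eexists.
    exists 0%N, (3 * L)%N; split; [| |reflexivity].
      by split=> // k _; rewrite !z0.
    by split=> [|k _]; [lia|rewrite !z0].
  rewrite !z0 !big_ord0 /potential /excess /correction !odd_ext_nneg ?subr0 //.
  rewrite /excess_half /correction_half K0 natrM mulfK ?gt_eqF // mul0r; lra.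
have [w Ew wle] := attained_points R K L (4 * L) (fun j => z j == i) _ _ K0 K1 L0
  (leqnn _) Ev.
have Ew' : attained K L (fun n => (hits z i.+1 n)%:R - n%:R * (i%:R / G%:R)) w.
  apply: attained_ext Ew => n nL; rewrite addrAC -natrD; congr (_%:R - _).
  rewrite /hits -(big_mkord xpredT (fun j => nat_of_bool (z j < i)%N)).
  rewrite -(big_mkord xpredT (fun j => nat_of_bool ((z j == i) && (j < n))%N)).
  rewrite -(big_mkord xpredT (fun j => nat_of_bool (z j < i.+1)%N)).
  rewrite [X in (_ + X)%N](big_cat_nat _ nL) //= [X in (_ + (_ + X))%N]big1_seq ?addn0.
    rewrite -big_split /=; apply: eq_big_nat => j /andP[_ ->].
    by rewrite andbT; lia.
  by move=> j; rewrite mem_index_iota => /andP[_ /andP[nj _]]; rewrite ltnNge nj andbF.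
have tau0 : 0 <= G%:R^-1 :> R by rewrite invr_ge0 ler0n.
have [u Eu ule] := attained_flow R K L _ _ _ K0 L0 tau0
  (uncrossed_hits R z (4 * L) G i G0 dG) Ew'.
exists u.
  by apply: attained_ext Eu => n _; rewrite -natr1; field; rewrite gt_eqF.
have pE : (fun n => (hits z i.+1 n)%:R - n%:R * (i%:R / G%:R) - n%:R * (G%:R^-1 / 2))
    = profile R z G i :> (nat -> R).
  by apply/funext => n; rewrite /profile; field; rewrite gt_eqF.
have gE : block_max (profile R z G i) (3 * L) L - block_max (profile R z G i) 0 L
    = gap (profile R z G i) 0 L by [].
rewrite pE gE in ule.
rewrite !big_ord_recr /= mulrDr; lra.
Qed.

(** At [x = 1] all the [Delta_n] vanish again, so the final value of the
potential is at least the initial one and the accumulated excess of [|f|] over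
[K] is nonnegative. *)
Lemma gap_average (R : realFieldType) (K : R) (z : nat -> nat) (L G : nat) :
  0 <= K -> K + 2 * K ^+ 2 <= 1 / 4 -> (0 < L)%N -> (0 < G)%N ->
  (forall d, (0 < d <= 4 * L)%N -> (d %| G)%N) ->
  (forall j, (j < 4 * L)%N -> (z j < G)%N) ->
  G%:R * K <= \sum_(i < G) `|gap (profile R z G i) 0 L|.
Proof.
move=> K0 K1 L0 G0 dG zG; have G0' : 0 < G%:R :> R by rewrite ltr0n.
have [v [p [q [Ap Aq ->]]]] := attained_line R K z L G G K0 K1 L0 G0 dG.
have sumG : \sum_(i < G) \sum_(j < 4 * L | z j == i) point_cost K L j = 0.
  rewrite -[RHS](sum_point_cost R K L) (exchange_big_dep xpredT) //=.
  apply: eq_bigr => j _; rewrite (big_pred1 (Ordinal (zG j (ltn_ord j)))) //.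
have end0 n : (n <= 4 * L)%N -> (hits z G n)%:R - n%:R * (G%:R / G%:R) = 0 :> R.
  move=> nL; rewrite divff ?gt_eqF // mulr1 /hits.
  rewrite (eq_bigr (fun _ => 1%N)) ?sum1_card ?card_ord ?subrr //.
  by move=> j _; rewrite zG //; have := ltn_ord j; lia.
have r01 := left_offset R _ L p L0 Ap; have s01 := right_offset R _ L q L0 Aq.
case: Ap Aq => pin _ [qin _]; rewrite !end0; [|lia|lia].
rewrite sumG sumrB sumr_const card_ord -[K *+ G]mulr_natl.
have -> : potential K (0 - 0) (1 - p%:R / L%:R) (q%:R / L%:R - 3)
    = ((q%:R / L%:R - 3) - (1 - p%:R / L%:R)) * (K ^+ 2 / 4).
  rewrite subr0 /potential /excess /correction !odd_ext_nneg //.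
  by rewrite /excess_half /correction_half K0; ring.
move=> h; rewrite -subr_ge0.
have N0 : 0 < (4 * L)%:R / G%:R :> R by rewrite divr_gt0 ?ltr0n //; lia.
rewrite -(pmulr_rge0 _ N0).
have : 0 <= (q%:R / L%:R - 3 + p%:R / L%:R) * (K ^+ 2 / 4).
  by apply: mulr_ge0; [lra|have := sqr_ge0 K; lra].
lra.
Qed.

(** * Growth of the spread with the length of the block *)

Lemma block_max_ub (R : realFieldType) (E : nat -> R) (a L k : nat) :
  (a <= k <= a + L)%N -> E k <= block_max E a L.
Proof. by have [p [_ pmax] ->] := block_max_argmax R E a L; apply: pmax. Qed.

Lemma block_max_le (R : realFieldType) (E F : nat -> R) (a b L M : nat) (c : R) :
  (forall k, (a <= k <= a + L)%N ->
     exists2 k', (b <= k' <= b + M)%N & E k <= c + F k') ->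
  block_max E a L <= c + block_max F b M.
Proof.
move=> EF; have [p [/EF[k kb EFk] _] ->] := block_max_argmax R E a L.
by have := block_max_ub R F b M k kb; lra.
Qed.

Lemma block_max_shift (R : realFieldType) (E F : nat -> R) (a b L : nat) (c : R) :
  (forall k, (k <= L)%N -> E (a + k)%N = c + F (b + k)%N) ->
  block_max E a L = c + block_max F b L.
Proof.
move=> EF; apply/eqP; rewrite eq_le; apply/andP; split.
  apply: block_max_le => k kin; exists (b + (k - a))%N; first by lia.
  by rewrite -EF ?subnKC //; lia.
rewrite addrC -lerBrDr addrC; apply: block_max_le => k kin.
exists (a + (k - b))%N; first by lia.
by rewrite EF ?subnKC ?addKr //; lia.
Qed.

Lemma block_max_rev (R : realFieldType) (E F : nat -> R) (a b L : nat) (c : R) :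
  (forall k, (k <= L)%N -> E (a + k)%N = c + F (b + (L - k))%N) ->
  block_max E a L = c + block_max F b L.
Proof.
move=> EF; apply/eqP; rewrite eq_le; apply/andP; split.
  apply: block_max_le => k kin; exists (b + (L - (k - a)))%N; first by lia.
  by rewrite -EF ?subnKC //; lia.
rewrite addrC -lerBrDr addrC; apply: block_max_le => k kin.
exists (a + (L - (k - b)))%N; first by lia.
by rewrite EF ?subKn ?subnKC ?addKr //; lia.
Qed.

Definition spread {R : realFieldType} (E : nat -> R) (a L : nat) : R :=
  block_max E a L + block_max (fun n => - E n) a L.

Lemma block_max_split (R : realFieldType) (E : nat -> R) (a L : nat) :
  (block_max E a L + block_max E (a + 3 * L) L) / 2 + `|gap E a L| / 2
    <= block_max E a (4 * L).
Proof.
have sub b : (a <= b)%N -> (b + L <= a + 4 * L)%N ->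
    block_max E b L <= block_max E a (4 * L).
  move=> ab bL; rewrite -[leRHS]add0r; apply: block_max_le => k kin.
  by exists k; [lia|rewrite add0r].
have h1 := sub a (leqnn _); have h2 := sub (a + 3 * L)%N.
rewrite /gap; case: (ler0P (block_max E (a + 3 * L) L - _)) => _.
  by have := h1 ltac:(lia); lra.
by have := h2 ltac:(lia) ltac:(lia); lra.
Qed.

Lemma spread_split (R : realFieldType) (E : nat -> R) (a L : nat) :
  (spread E a L + spread E (a + 3 * L) L) / 2
    + (`|gap E a L| + `|gap (fun n => - E n) a L|) / 2
  <= spread E a (4 * L).
Proof.
rewrite /spread; have := block_max_split R E a L.
have := block_max_split R (fun n => - E n) a L; lra.
Qed.

Lemma hits_add (z : nat -> nat) (i a n : nat) :
  hits z i (a + n) = (hits z i a + hits (fun j => z (a + j)%N) i n)%N.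
Proof. by rewrite /hits big_split_ord. Qed.

Lemma gap_shift (R : realFieldType) (E F : nat -> R) (a L : nat) (c : R) :
  (forall k, E (a + k)%N = c + F k) -> gap E a L = gap F 0 L.
Proof.
move=> EF; have shift b : block_max E (a + b) L = c + block_max F (0 + b) L.
  by apply: block_max_shift => k _; rewrite -addnA EF add0n.
have := shift 0%N; rewrite !addn0 => s0.
by rewrite /gap shift s0; ring.
Qed.

Lemma profile_add (R : realFieldType) (z : nat -> nat) (G i a k : nat) :
  profile R z G i (a + k)
  = profile R z G i a + profile R (fun j => z (a + j)%N) G i k.
Proof. by rewrite /profile hits_add !natrD; ring. Qed.

Lemma hits_rev (z : nat -> nat) (i N n : nat) : (n <= N)%N ->
  hits z i N = (hits z i n + hits (fun j => z (N - j.+1)%N) i (N - n))%N.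
Proof.
move=> nN; rewrite -{1}(subnKC nN) hits_add; congr addn.
rewrite /hits (reindex_inj rev_ord_inj) /=; apply: eq_bigr => j _.
by congr (z _ < i)%N; have := ltn_ord j; lia.
Qed.

(** Minima reduce to maxima by reading the block backwards: up to a term that
depends on [i] only, [- Delta_(4 L - n)] is the profile of the reversed
sequence. *)
Lemma gap_opp (R : realFieldType) (z : nat -> nat) (G i L : nat) :
  `|gap (fun n => - profile R z G i n) 0 L|
  = `|gap (profile R (fun j => z (4 * L - j.+1)%N) G i) 0 L|.
Proof.
have rev b b' : (b + b' = 3 * L)%N ->
    block_max (fun n => - profile R z G i n) (0 + b) L
    = - profile R z G i (4 * L)
      + block_max (profile R (fun j => z (4 * L - j.+1)%N) G i) (0 + b') L.
  move=> bb; apply: block_max_rev => k kL; rewrite /profile !add0n.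
  have bk : (b + k <= 4 * L)%N by lia.
  rewrite (hits_rev z i.+1 _ _ bk).
  have -> : (b' + (L - k) = 4 * L - (b + k))%N by lia.
  by rewrite natrD natrB //; ring.
have := rev 0%N (3 * L)%N erefl; rewrite !addn0 => r0.
rewrite /gap (rev (3 * L)%N 0%N) ?addn0 // r0 distrC.
by congr `|_|; ring.
Qed.

Lemma spread_average (R : realFieldType) (K : R) (z : nat -> nat) (G t a : nat) :
  0 <= K -> K + 2 * K ^+ 2 <= 1 / 4 -> (0 < G)%N ->
  (forall d, (0 < d <= 4 ^ t)%N -> (d %| G)%N) -> (forall j, (z j < G)%N) ->
  t%:R * (G%:R * K) <= \sum_(i < G) spread (profile R z G i) a (4 ^ t).
Proof.
move=> K0 K1 G0; elim: t a => [|t IH] a dG zG.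
  rewrite mul0r; apply: sumr_ge0 => i _; rewrite /spread.
  have aa : (a <= a <= a + 4 ^ 0)%N by lia.
  have := block_max_ub R (profile R z G i) a (4 ^ 0) a aa.
  have := block_max_ub R (fun n => - profile R z G i n) a (4 ^ 0) a aa; lra.
have dG' d : (0 < d <= 4 ^ t)%N -> (d %| G)%N.
  by move=> dt; apply: dG; rewrite expnS; lia.
have dG4 d : (0 < d <= 4 * 4 ^ t)%N -> (d %| G)%N by rewrite -expnS; exact: dG.
have L0 : (0 < 4 ^ t)%N by rewrite expn_gt0.
rewrite expnS; set L := (4 ^ t)%N in dG4 L0 *.
have g1 := gap_average R K (fun j => z (a + j)%N) L G K0 K1 L0 G0 dG4 (fun j _ => zG _).
have g2 := gap_average R K (fun j => z (a + (4 * L - j.+1))%N) L G K0 K1 L0 G0 dG4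
  (fun j _ => zG _).
have i1 := IH a dG' zG; have i2 := IH (a + 3 * L)%N dG' zG.
rewrite -/L in i1 i2.
have : \sum_(i < G) ((spread (profile R z G i) a L
      + spread (profile R z G i) (a + 3 * L) L) / 2
    + (`|gap (profile R (fun j => z (a + j)%N) G i) 0 L|
      + `|gap (profile R (fun j => z (a + (4 * L - j.+1))%N) G i) 0 L|) / 2)
   <= \sum_(i < G) spread (profile R z G i) a (4 * L).
  apply: ler_sum => i _; apply: le_trans (spread_split _ _ _ _).
  rewrite -(gap_opp R (fun j => z (a + j)%N)).
  rewrite (gap_shift R _ _ _ _ _ (profile_add R z G i a)).
  rewrite (gap_shift R (fun n => - profile R z G i n) _ _ _ _
    (fun k => etrans (congr1 -%R (profile_add R z G i a k)) (opprD _ _))).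
  by [].
have split4 (f g h k : 'I_G -> R) :
    \sum_(i < G) ((f i + g i) / 2 + (h i + k i) / 2)
    = (\sum_(i < G) f i + \sum_(i < G) g i) / 2
      + (\sum_(i < G) h i + \sum_(i < G) k i) / 2.
  by rewrite big_split /= -!mulr_suml !big_split.
rewrite split4 -[t.+1%:R]natr1; lra.
Qed.

(** * From the spread to the star discrepancy *)

Definition grid_cell {R : realType} (w : nat -> R) (G j : nat) : nat :=
  Num.truncn (w j * G%:R).

Lemma grid_cell_lt (R : realType) (w : nat -> R) (G j : nat) :
  unit_sequence w -> (0 < G)%N -> (grid_cell w G j < G)%N.
Proof.
move=> /(_ j)/andP[w0 w1] G0; have G0' : 0 < G%:R :> R by rewrite ltr0n.
by rewrite truncn_lt_nat ?mulr_ge0 ?ler0n // gtr_pMl.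
Qed.

Lemma hits_grid_cell (R : realType) (w : nat -> R) (G i n : nat) :
  (0 < G)%N ->
  hits (grid_cell w G) i.+1 n = count_below w n (i.+1%:R / G%:R).
Proof.
move=> G0; have G0' : 0 < G%:R :> R by rewrite ltr0n.
rewrite /hits /count_below -sum1_card [RHS]big_mkcond /=; apply: eq_bigr => j _.
by rewrite ltnS truncn_le_nat -ltr_pdivlMr // inE; case: ifP.
Qed.

Lemma discrepancy_le_star (R : realType) (w : nat -> R) (n : nat) (x : R) :
  (0 < n)%N -> 0 <= x <= 1 ->
  `|(count_below w n x)%:R / n%:R - x| <= star_discrepancy w n.
Proof.
move=> n0 x01; have n0' : 0 < n%:R :> R by rewrite ltr0n.
apply: ub_le_sup; last by exists x => //=; rewrite in_itv.
exists 1 => _ /= [y + <-]; rewrite in_itv /= => y01.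
have : 0 <= ((count_below w n y)%:R / n%:R : R) <= 1.
  rewrite divr_ge0 ?ler0n //= ler_pdivrMr // mul1r ler_nat.
  by rewrite -[leqRHS](card_ord n) max_card.
by rewrite ler_norml; lra.
Qed.

(** Rounding does not change the counts at the points of the grid, so the middle
of a cell only differs from its right end by [n / (2 G)]. *)
Lemma profile_le_star (R : realType) (w : nat -> R) (G i n : nat) :
  (i < G)%N -> (0 < n <= G)%N ->
  `|profile R (grid_cell w G) G i n| <= n%:R * star_discrepancy w n + 1.
Proof.
move=> iG /andP[n0 nG]; have G0 : (0 < G)%N by lia.
have G0' : 0 < G%:R :> R by rewrite ltr0n.
have n0' : 0 < n%:R :> R by rewrite ltr0n.
have x01 : 0 <= (i.+1%:R / G%:R : R) <= 1.
  by rewrite divr_ge0 ?ler0n //= ler_pdivrMr // mul1r ler_nat.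
have := discrepancy_le_star R w n _ n0 x01.
rewrite /profile hits_grid_cell //; set c := (count_below _ _ _)%:R => cle.
have -> : c - n%:R * ((i%:R + 1 / 2) / G%:R)
    = n%:R * (c / n%:R - i.+1%:R / G%:R) + n%:R / G%:R / 2.
  by rewrite -[i.+1%:R]natr1; field; rewrite !gt_eqF.
apply: le_trans (ler_normD _ _) _; apply: lerD.
  by rewrite normrM gtr0_norm // ler_pM2l.
have : 0 <= (n%:R / G%:R : R) <= 1.
  by rewrite divr_ge0 ?ler0n //= ler_pdivrMr // mul1r ler_nat.
by rewrite ler_norml; lra.
Qed.

Lemma spread_le (R : realFieldType) (E : nat -> R) (a L : nat) (M : R) :
  (forall k, (a <= k <= a + L)%N -> `|E k| <= M) -> spread E a L <= 2 * M.
Proof.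
move=> EM; rewrite /spread.
have [p [pin _] ->] := block_max_argmax R E a L.
have [q [qin _] ->] := block_max_argmax R (fun n => - E n) a L.
by have := EM p pin; have := EM q qin; rewrite !ler_norml; lra.
Qed.

(** If the inequality failed from [m] on, the spread over the indices from [m] to
[m + 4 ^ t] would be at most [2 c t ln 4 + O(1)], against [t K] from
[spread_average]. *)
Lemma lower_constant_of_average (R : realType) (K c : R) :
  0 <= K -> K + 2 * K ^+ 2 <= 1 / 4 -> 0 <= c -> 4 * c * ln 2 < K ->
  discrepancy_lower_constant c.
Proof.
move=> K0 K1 c0 cK w hw fin; have [s sE] := (finite_seqP _).1 fin.
pose m := (\max_(n <- s) n).+1.
have small n : (m <= n)%N -> n%:R * star_discrepancy w n <= c * ln n%:R.
  move=> mn; have n0 : (0 < n)%N by rewrite (leq_trans _ mn).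
  have n0' : 0 < n%:R :> R by rewrite ltr0n.
  rewrite -ler_pdivlMl // mulrC -mulrA leNgt; apply/negP => big.
  have : [set` s] n by rewrite -sE.
  move=> /= ns; have := @leq_bigmax_seq _ s xpredT (fun n => n) n ns isT.
  by rewrite leqNgt => /negP; apply.
(* [B] is the part of the upper bound that does not depend on [t]. *)
pose B := 2 * c * ln m.+1%:R + 2.
pose t := (Num.truncn (B / (K - 4 * c * ln 2))).+1.
have tB : B < t%:R * (K - 4 * c * ln 2).
  by rewrite -ltr_pdivrMr ?subr_gt0 // truncnS_gt.
pose N := (m + 4 ^ t)%N; pose G := N`!%N.
have G0 : (0 < G)%N := fact_gt0 N.
have G0' : 0 < G%:R :> R by rewrite ltr0n.
have dG d : (0 < d <= 4 ^ t)%N -> (d %| G)%N.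
  by move=> /andP[d0 dt]; apply: dvdn_fact; rewrite d0 (leq_trans dt) // leq_addl.
have := spread_average R K _ G t m K0 K1 G0 dG (fun j => grid_cell_lt R w G j hw G0).
have lnN : ln N%:R <= ln m.+1%:R + t%:R * (2 * ln 2) :> R.
  have -> : 2 * ln 2 = ln (4 : R).
    by rewrite (_ : 4 = 2 ^+ 2) ?lnXn ?mulr_natl //; ring.
  have p4 : (4%:R ^+ t : R) \is Num.pos by rewrite posrE exprn_gt0.
  rewrite [X in _ + X]mulr_natl -lnXn // -lnM ?posrE ?exprn_gt0 ?ltr0n //.
  rewrite ler_ln ?posrE ?mulr_gt0 ?exprn_gt0 ?ltr0n ?addn_gt0 ?expn_gt0 ?orbT //.
  rewrite -natrX -natrM ler_nat.
  by rewrite /N; have := expn_gt0 4 t; nia.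
have bound i : (i < G)%N ->
    spread (profile R (grid_cell w G) G i) m (4 ^ t) <= 2 * (c * ln N%:R + 1).
  move=> iG; apply: spread_le => k /andP[mk kN].
  have k0 : (0 < k)%N by apply: leq_trans mk.
  have kG : (0 < k <= G)%N by rewrite k0 (leq_trans kN) // fact_geq.
  apply: le_trans (profile_le_star R w G i k iG kG) _; rewrite lerD2r.
  apply: le_trans (small k mk) _; apply: ler_wpM2l => //.
  by rewrite ler_ln ?posrE ?ltr0n ?ler_nat // addn_gt0.
have : \sum_(i < G) spread (profile R (grid_cell w G) G i) m (4 ^ t)
    <= \sum_(i < G) 2 * (c * ln N%:R + 1).
  by apply: ler_sum => i _; apply: bound.
rewrite sumr_const card_ord -[_ *+ G]mulr_natl => le1 le2.
have := le_trans le2 le1; rewrite mulrCA ler_pM2l // => tK.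
have := ler_wpM2l c0 lnN; rewrite /B in tB; lra.
Qed.

(** [ln 2 <= 256 ln x <= 256 (x - 1)] as soon as [x ^ 256 >= 2]; the power is
bounded below by eight squarings with rounding. *)
Lemma ln2_lt (R : realType) : ln 2 < 694 / 10 ^+ 3 + 8 / 10 ^+ 4 :> R.
Proof.
pose x : R := 1 + (2 / 10 ^+ 3 + 714 / 10 ^+ 6).
have sq n (b d : R) : b <= x ^+ (2 ^ n)%N -> 0 <= b -> d <= b ^+ 2 ->
    d <= x ^+ (2 ^ n.+1)%N.
  move=> bx b0 db; apply: le_trans db _; rewrite expnSr exprM lerXn2r ?nnegrE //.
  exact: le_trans bx.
have h0 : 1 + 2 / 10 ^+ 3 + 714 / 10 ^+ 6 <= x ^+ (2 ^ 0)%N by rewrite expn0 expr1 /x; lra.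
have h1 : 1 + 5 / 10 ^+ 3 + 435 / 10 ^+ 6 <= x ^+ (2 ^ 1)%N by apply: (sq 0%N _ _ h0); lra.
have h2 : 1 + 10 / 10 ^+ 3 + 899 / 10 ^+ 6 <= x ^+ (2 ^ 2)%N by apply: (sq 1%N _ _ h1); lra.
have h3 : 1 + 21 / 10 ^+ 3 + 916 / 10 ^+ 6 <= x ^+ (2 ^ 3)%N by apply: (sq 2%N _ _ h2); lra.
have h4 : 1 + 44 / 10 ^+ 3 + 310 / 10 ^+ 6 <= x ^+ (2 ^ 4)%N by apply: (sq 3%N _ _ h3); lra.
have h5 : 1 + 90 / 10 ^+ 3 + 580 / 10 ^+ 6 <= x ^+ (2 ^ 5)%N by apply: (sq 4%N _ _ h4); lra.
have h6 : 1 + 189 / 10 ^+ 3 + 360 / 10 ^+ 6 <= x ^+ (2 ^ 6)%N by apply: (sq 5%N _ _ h5); lra.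
have h7 : 1 + 414 / 10 ^+ 3 + 570 / 10 ^+ 6 <= x ^+ (2 ^ 7)%N by apply: (sq 6%N _ _ h6); lra.
have h8 : 2 <= x ^+ (2 ^ 8)%N by apply: (sq 7%N _ _ h7); lra.
have x0 : 0 < x by rewrite /x; lra.
have : ln 2 <= ln (x ^+ (2 ^ 8)%N) by rewrite ler_ln ?posrE ?exprn_gt0.
rewrite lnXn // -[ln x *+ _]mulr_natl natrX.
have : ln x <= 2 / 10 ^+ 3 + 714 / 10 ^+ 6 by apply: le_ln1Dx; lra.
lra.
Qed.

Theorem theorem1 (R : realType) :
  ((65 / 10 ^+ 3 + 664 / 10 ^+ 6 + 679 / 10 ^+ 9 : R)%:E
     <= star_discrepancy_constant R)%E.
Proof.
set c : R := 65 / 10 ^+ 3 + 664 / 10 ^+ 6 + 679 / 10 ^+ 9.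
apply: ereal_sup_ubound; exists c => //; split; first by rewrite /c; lra.
apply: (lower_constant_of_average R (73 / 400)); rewrite /c; [lra|lra|lra|].
by have := ln2_lt R; lra.
Qed.
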